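(* For any composition $\boldsymbol{k}=(k_1,\ldots,k_r)$ and any $k\in\mathbb{N}_0$, with $n:=|\boldsymbol{k}|+1-\mathrm{dep}(\boldsymbol{k})$, $$\eta(k+1;\boldsymbol{k})=(-1)^{r-1}\sum_{\substack{\boldsymbol{j}\in\mathbb{N}_0^n\\ |\boldsymbol{j}|=k}}B\big((\overleftarrow{\boldsymbol{k}}^\vee)_+;\boldsymbol{j}\big)\,\zeta^\star\big((\overleftarrow{\boldsymbol{k}}^\vee)_++\boldsymbol{j}\big).$$
   Context: $\mathbb{N}$ is the set of positive integers, $\mathbb{N}_0=\mathbb{N}\cup\{0\}$. A composition is a finite sequence $\boldsymbol{k}=(k_1,\ldots,k_r)\in\mathbb{N}^r$, $r\ge 1$; its weight is $|\boldsymbol{k}|=k_1+\cdots+k_r$ and its depth is $\mathrm{dep}(\boldsymbol{k})=r$ (also $|\boldsymbol{j}|$ is the sum of the entries for $\boldsymbol{j}\in\mathbb{N}_0^n$). The reversal is $\overleftarrow{\boldsymbol{k}}=(k_r,\ldots,k_1)$, and $\boldsymbol{k}_+=(k_1+1,k_2,\ldots,k_r)$. The Hoffman dual $\boldsymbol{k}^\vee=(k'_1,\ldots,k'_{r'})$ of $\boldsymbol{k}$ is the unique composition of the same weight such that $\{1,2,\ldots,|\boldsymbol{k}|-1\}$ is the disjoint union of $\{\sum_{i=1}^{j}k_i: 1\le j\le r-1\}$ and $\{\sum_{i=1}^{j}k'_i:1\le j\le r'-1\}$. The notation $\overleftarrow{\boldsymbol{k}}^\vee$ means $(\overleftarrow{\boldsymbol{k}})^\vee$;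 it has depth $n=|\boldsymbol{k}|+1-\mathrm{dep}(\boldsymbol{k})$. For $\boldsymbol{k}\in\mathbb{N}^r$ and $\boldsymbol{j}\in\mathbb{N}_0^r$, $\boldsymbol{k}+\boldsymbol{j}$ is the componentwise sum and $B(\boldsymbol{k};\boldsymbol{j})=\prod_{i=1}^r\binom{k_i+j_i-1}{j_i}$. For a composition with $k_1>1$, the multiple zeta star value is $\zeta^\star(\boldsymbol{k})=\sum_{n_1\ge\cdots\ge n_r>0}\frac{1}{n_1^{k_1}\cdots n_r^{k_r}}$. The multiple polylogarithm is $\mathrm{Li}_{\boldsymbol{k}}(z)=\sum_{n_1>\cdots>n_r>0}\frac{z^{n_1}}{n_1^{k_1}\cdots n_r^{k_r}}$ for $z\in[-1,1)$. It is extended to all real $z<1$ by analytic continuation along the real line, equivalently by the iterated integral $$\mathrm{Li}_{\boldsymbol{k}}(z)=\int_0^z\Big(\frac{dt}{1-t}\Big)\Big(\frac{dt}{t}\Big)^{k_r-1}\cdots\Big(\frac{dt}{1-t}\Big)\Big(\frac{dt}{t}\Big)^{k_1-1},$$ where the leftmost form is integrated first (innermost variable, closest to $0$) and the rightmost last. For $\Re(s)>0$ the Kaneko–Tsumura $\eta$-function is $$\eta(s;\boldsymbol{k})=\frac{1}{\Gamma(s)}\int_0^\infty\frac{t^{s-1}}{1-e^t}\mathrm{Li}_{\boldsymbol{k}}(1-e^t)\,dt.$$ *)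

(* Defs.v *)
From mathcomp Require Import all_boot all_order all_algebra.
From mathcomp Require Import all_classical all_reals all_analysis.
From mathcomp Require Import zify.
Import Order.TTheory GRing.Theory Num.Theory.

Set Implicit Arguments.
Unset Strict Implicit.
Unset Printing Implicit Defensive.

Local Open Scope ring_scope.

Section Compositions.
Local Open Scope nat_scope.

Definition is_composition (k : seq nat) : bool :=
  (0 < size k) && all (fun i => 0 < i) k.

(* The partial sums k_1 + ... + k_j for 1 <= j <= r - 1. *)
Definition cuts (k : seq nat) : seq nat :=
  [seq sumn (take j k) | j <- iota 1 (size k).-1].

(* For s increasing in {1, ..., w - 1}: the composition of weight w whose
   partial sums (the last one excepted) are the elements of s. *)
Definition composition_of_cuts (w : nat) (s : seq nat) : seq nat :=
  pairmap (fun a b => b - a) 0 (rcons s w).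

(* The lemmas below show that this is the unique composition of weight sumn k
   whose cuts are the complement of those of k in {1, ..., sumn k - 1}. *)
Definition hoffman_dual (k : seq nat) : seq nat :=
  composition_of_cuts (sumn k)
    [seq m <- iota 1 (sumn k).-1 | m \notin cuts k].

Definition incr_first (k : seq nat) : seq nat :=
  if k is k1 :: k' then k1.+1 :: k' else [::].

(* The two operations below are only meant for k and j of the same size. *)
Definition add_seq (k j : seq nat) : seq nat := [seq p.1 + p.2 | p <- zip k j].

Definition B_coef (k j : seq nat) : nat :=
  \prod_(p <- zip k j) 'C(p.1 + p.2 - 1, p.2).

Lemma sumn_take_pairmap (s : seq nat) x j : path leq x s -> j <= size s ->
  sumn (take j (pairmap (fun a b => b - a) x s)) + x = nth x (x :: s) j.
Proof.
elim: s x j => [|y s IH] x [|j] //= /andP[xy ys] js.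
rewrite addnAC subnK// addnC IH//.
by case: j js => [|j] //= js; apply: set_nth_default.
Qed.

Lemma iota1_rcons w : 0 < w -> iota 1 w = rcons (iota 1 w.-1) w.
Proof. by case: w => // w _; rewrite -cats1 -(iotaD 1 w 1) addn1. Qed.

Lemma all_pairmap_sub (s : seq nat) x : path ltn x s =
  all (fun i => 0 < i) (pairmap (fun a b => b - a) x s).
Proof. by elim: s x => [|y s IH] x //=; rewrite subn_gt0 IH. Qed.

Lemma composition_of_cutsP w s : path ltn 0 (rcons s w) ->
  [/\ is_composition (composition_of_cuts w s),
      sumn (composition_of_cuts w s) = w
    & cuts (composition_of_cuts w s) = s].
Proof.
move=> sw; rewrite /composition_of_cuts.
have sw' : path leq 0 (rcons s w) by apply: sub_path sw => a b /ltnW.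
split.
- by rewrite /is_composition size_pairmap size_rcons -all_pairmap_sub.
- have := sumn_take_pairmap sw' (leqnn _).
  by rewrite take_oversize ?size_pairmap// addn0 size_rcons /= nth_rcons ltnn eqxx.
- rewrite /cuts size_pairmap size_rcons /=.
  apply: (@eq_from_nth _ 0); first by rewrite size_map size_iota.
  move=> i; rewrite size_map size_iota => is_.
  rewrite (nth_map 0) ?size_iota// nth_iota// add1n.
  have := @sumn_take_pairmap _ 0 i.+1 sw'.
  by rewrite addn0 size_rcons /= nth_rcons is_ => -> //; apply: ltnW.
Qed.

Lemma composition_of_cutsK k : is_composition k ->
  composition_of_cuts (sumn k) (cuts k) = k.
Proof.
case: k => [|a k] // _; rewrite /composition_of_cuts.
have -> : rcons (cuts (a :: k)) (sumn (a :: k)) =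
    [seq sumn (take j (a :: k)) | j <- iota 1 (size (a :: k))].
  by rewrite iota1_rcons// map_rcons take_size.
have gen : forall (l : seq nat) c x,
    pairmap (fun a b => b - a) (c + x) [seq c + sumn (take j (x :: l)) | j <- iota 2 (size l)] = l.
  elim=> [|b l IH] c x //=.
  rewrite take0 /= addn0; congr cons; first by lia.
  rewrite -[RHS](IH (c + x) b) addnA; congr pairmap.
  rewrite -[3]/(1 + 2) iotaDl -map_comp; apply: eq_map => j /=.
  by rewrite addnA.
rewrite /= take0 /= addn0 subn0; congr cons.
by have := gen k 0 a; rewrite add0n.
Qed.

Lemma sorted_cuts k : is_composition k ->
  path ltn 0 (rcons (cuts k) (sumn k)).
Proof.
move=> kc; have := composition_of_cutsK kc; rewrite /composition_of_cuts.
by case/andP: kc => _ + E; rewrite all_pairmap_sub E.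
Qed.

Lemma hoffman_dual_path k : is_composition k ->
  path ltn 0 (rcons [seq m <- iota 1 (sumn k).-1 | m \notin cuts k] (sumn k)).
Proof.
move=> /andP[k0 /allP kp].
have w0 : 0 < sumn k.
  by case: k k0 kp => [|a k] //= _ kp; have := kp a (mem_head _ _); lia.
have : subseq (rcons [seq m <- iota 1 (sumn k).-1 | m \notin cuts k] (sumn k))
              (iota 1 (sumn k)).
  rewrite [X in subseq _ X](iota1_rcons w0) -!cats1.
  by apply: cat_subseq (subseq_refl _); apply: filter_subseq.
move=> sub; rewrite path_sortedE; last exact: ltn_trans.
rewrite (subseq_sorted ltn_trans sub) ?iota_ltn_sorted// andbT.
by apply/allP => x /(mem_subseq sub); rewrite mem_iota => /andP[].
Qed.

Lemma hoffman_dualP k : is_composition k ->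
  [/\ is_composition (hoffman_dual k),
      sumn (hoffman_dual k) = sumn k
    & cuts (hoffman_dual k) =
        [seq m <- iota 1 (sumn k).-1 | m \notin cuts k]].
Proof. by move=> /hoffman_dual_path /composition_of_cutsP. Qed.

Lemma hoffman_dual_unique k k' :
  is_composition k -> is_composition k' -> sumn k' = sumn k ->
  (forall m, 0 < m < sumn k -> (m \in cuts k') = (m \notin cuts k)) ->
  k' = hoffman_dual k.
Proof.
move=> kc kc' ww H; rewrite -(composition_of_cutsK kc') ww; congr composition_of_cuts.
have := sorted_cuts kc'; rewrite ww => p'.
have /andP[p1 p2] : sorted ltn (cuts k') && all (fun m => 0 < m < sumn k) (cuts k').
  move: p'; rewrite path_sortedE; last exact: ltn_trans.
  rewrite all_rcons => /andP[/andP[_ gt0]].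
  rewrite -cats1 (sorted_pairwise ltn_trans) pairwise_cat allrel1r.
  case/and3P=> lt s' _; rewrite (sorted_pairwise ltn_trans) s' /=.
  by rewrite -[X in all X _]/(fun m => predI (ltn 0) (ltn^~ (sumn k)) m) all_predI gt0.
apply: (irr_sorted_eq ltn_trans ltnn) => //.
  exact: (sorted_filter ltn_trans _ (iota_ltn_sorted _ _)).
move=> m; rewrite mem_filter mem_iota; apply/idP/andP => [mc|[mn mi]].
  by have /= b := allP p2 _ mc; rewrite -(H m b) mc; split => //; lia.
by rewrite H //; lia.
Qed.

Lemma size_hoffman_dual k : is_composition k ->
  size (hoffman_dual k) = sumn k + 1 - size k.
Proof.
move=> kc; rewrite /hoffman_dual /composition_of_cuts size_pairmap size_rcons.
have := sorted_cuts kc; rewrite (path_sortedE ltn_trans) all_rcons.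
move=> /andP[/andP[w0 gt0]].
rewrite -cats1 (sorted_pairwise ltn_trans) pairwise_cat allrel1r.
case/and3P=> /allP lt s' _.
have u : uniq (cuts k).
  by apply: (sorted_uniq ltn_trans ltnn); rewrite (sorted_pairwise ltn_trans).
have E : count [in cuts k] (iota 1 (sumn k).-1) = size (cuts k).
  rewrite -size_filter; apply/perm_size/uniq_perm => //.
    by rewrite filter_uniq// iota_uniq.
  move=> m; rewrite mem_filter mem_iota.
  case mc : (m \in cuts k) => //=.
  by have := allP gt0 m mc; have := lt m mc; rewrite /=; lia.
have := count_predC [in cuts k] (iota 1 (sumn k).-1).
rewrite E size_iota /cuts size_map size_iota size_filter.
rewrite -/(cuts k) => EE.
have k0 : 0 < size k by case/andP: kc.
have -> : count (fun m => m \notin cuts k) (iota 1 (sumn k).-1) =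
          count (predC [in cuts k]) (iota 1 (sumn k).-1) by [].
have {}w0 : 0 < sumn k by [].
lia.
Qed.

End Compositions.

Section Functions.
Variable R : realType.
Local Notation mu := (@lebesgue_measure R).

(* The index n_1 >= ... >= n_r > 0 is a tuple; the terms being nonnegative, the
   sum is taken unordered in [0, +oo]. *)
Definition zeta_star (k : seq nat) : \bar R :=
  (\esum_(n in [set n : (size k).-tuple nat |
                 sorted geq n && all (leq 1) n]%classic)
    (\prod_(i < size k) ((tnth n i)%:R ^+ nth 0%N k i)^-1)%:E)%E.

Definition oriented_integral (a b : R) (f : R -> R) : R :=
  if a <= b then \int[mu]_(t in `[a, b]) f t
  else - \int[mu]_(t in `[b, a]) f t.

(* The head of ws is the form integrated first (innermost). *)
Definition iterated_integral (ws : seq (R -> R)) : R -> R :=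
  foldl (fun F w z => oriented_integral 0 z (fun t => F t * w t))
    (fun=> 1) ws.

(* The multiple polylogarithm on z < 1. The forms dt/t and dt/(1-t) are given
   by their densities; the value 0^-1 = 0 at t = 0 is immaterial. *)
Definition Li (k : seq nat) (z : R) : R :=
  iterated_integral
    (flatten [seq (fun t : R => (1 - t)^-1) :: nseq (ki - 1) (fun t : R => t^-1)
             | ki <- rev k]) z.

Definition Gamma (s : R) : R :=
  \int[mu]_(t in `]0, +oo[) (t `^ (s - 1) * expR (- t)).

(* The Kaneko-Tsumura eta function at real s > 0; the integrand has constant
   sign, so the integral always makes sense in the extended reals. *)
Definition eta (s : R) (k : seq nat) : \bar R :=
  ((Gamma s)^-1%:E *
   \int[mu]_(t in `]0%R, +oo[)
     (t `^ (s - 1) / (1 - expR t) * Li k (1 - expR t))%:E)%E.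

End Functions.

(* Main.v *)
Require Import Defs.
From mathcomp Require Import all_boot all_order all_algebra.
From mathcomp Require Import all_classical all_reals all_analysis.
From mathcomp Require Import measurable_realfun.
From mathcomp Require Import zify ring.
Import Order.TTheory GRing.Theory Num.Theory.
Import numFieldNormedType.Exports.
Local Open Scope ring_scope.

Set Implicit Arguments.
Unset Strict Implicit.
Unset Printing Implicit Defensive.

(* With z = 1 - e^t, the forms dz/(1-z) and dz/z become -dt and
   dt/(1-e^(-t)) = (sum_(p >= 0) e^(-pt)) dt, so up to the sign (-1)^r every
   integrand is nonnegative and Tonelli's theorem moves the whole iterated
   integral Li onto t^m/(e^t-1) = sum_(n >= 1) e^(-nt) t^m. Each form then acts
   on the span of the functions e^(-nt) t^i/i!: integrating from t to infinity
   sends e^(-nt) t^i/i! to sum_(x <= i) n^(-x-1) e^(-nt) t^(i-x)/(i-x)!, and the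
   factor 1/(1-e^(-t)) turns coefficients into their partial sums over n. Hence
   dz/z opens a new component of the star sum and dz/(1-z) increases the current
   exponent by one, which is the composition read off the Hoffman dual of the
   reversal of k; the powers of t produce the factor
   sum_j C(a+j-1,j) x^j n^(-a-j) = (n-x)^(-a) that accounts for B. *)

(** * Words and Hoffman duality *)

Section Words.
Local Open Scope nat_scope.

(* The letter [true] stands for dt/t and [false] for dt/(1-t), in the order of
   integration of [Li]. *)
Definition Li_word (k : seq nat) : seq bool :=
  flatten [seq false :: nseq (ki - 1) true | ki <- rev k].

(** Meant for words ending in [true]: that last letter creates the last component, so [incr_first]
    never meets the empty list. *)
Definition composition_of_word (u : seq bool) : seq nat :=
  foldr (fun c l => if c then 1 :: l else incr_first l) [::] u.

Lemma size_incr_first l : size (incr_first l) = size l.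
Proof. by case: l. Qed.

Lemma cuts_cons a b l : cuts (a :: b :: l) = a :: map (addn a) (cuts (b :: l)).
Proof.
rewrite /cuts /= addn0; congr cons.
rewrite -[2]/(1 + 1) iotaDl -!map_comp; apply: eq_map => j /=.
by rewrite add0n.
Qed.

Lemma cuts_incr_first l : cuts (incr_first l) = map succn (cuts l).
Proof.
case: l => // a [|b l]; first by [].
rewrite [incr_first _]/= !cuts_cons /=; congr cons.
by rewrite -map_comp; apply: eq_map => j /=.
Qed.

Lemma composition_of_word_cons v :
  exists a l, composition_of_word (rcons v true) = a.+1 :: l.
Proof.
elim: v => [|c v [a [l IH]]] /=; first by exists 0, [::].
by rewrite IH; case: c => /=; [exists 0, (a.+1 :: l)|exists a.+1, l].
Qed.

Lemma composition_of_wordP v : is_composition (composition_of_word (rcons v true)).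
Proof.
apply/andP; split; first by have [a [l ->]] := composition_of_word_cons v.
elim: v => [|c v] //=; have [a [l ->]] := composition_of_word_cons v.
by case: c.
Qed.

Lemma sumn_composition_of_word v :
  sumn (composition_of_word (rcons v true)) = (size v).+1.
Proof.
elim: v => [|c v] //=; have [a [l ->]] := composition_of_word_cons v.
by case: c => /= <-.
Qed.

(** A letter put in front of a word shifts every cut by one, and a [true] adds the cut 1. Thus the
    letters of v, numbered from 1, form the indicator of the set of cuts, and negating them
    complements this set. *)
Lemma mem_cuts_word v m :
  (m.+1 \in cuts (composition_of_word (rcons v true))) = nth false v m.
Proof.
elim: v m => [|c v IH] m; first by rewrite nth_nil.
have [a [l E]] := composition_of_word_cons v.
case: c => /=.
  rewrite E cuts_cons -E in_cons; case: m => [|m] //=.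
  by rewrite (mem_map (@addnI 1)) IH.
rewrite cuts_incr_first (mem_map succn_inj); case: m => [|m] /=; last exact: IH.
apply/negbTE/mapP => -[j]; rewrite E mem_iota => /andP[j0 _].
by case: j j0 => //= j _ /esym.
Qed.

Lemma behead_Li_word_rev a k : behead (Li_word (rev (a :: k))) =
  nseq (a - 1) true ++ Li_word (rev k).
Proof. by rewrite /Li_word !revK. Qed.

Lemma Li_word_cons k : is_composition k ->
  Li_word k = false :: behead (Li_word k).
Proof.
rewrite -{2 3}(revK k) /Li_word => /andP[k0 _].
by rewrite !revK; case: (rev k) (size_rev k) => // E; rewrite -E in k0.
Qed.

(** Without its leading [false], the word of the reversal is made of runs of a - 1 letters [true]
    separated by single letters [false]. After negation each run, closed by the next [true], builds
    one component a. *)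
Lemma composition_of_Li_word k : is_composition k ->
  composition_of_word (rcons (map negb (behead (Li_word (rev k)))) true) = k.
Proof.
elim: k => // a [|b k] IH /andP[_ /andP[a0 kp]].
all: rewrite behead_Li_word_rev map_cat map_nseq rcons_cat /composition_of_word foldr_cat.
all: rewrite -(subnK a0) addnK addn1 -/(composition_of_word _).
  by elim: (a - 1) => //= n ->.
have kc : is_composition (b :: k) by [].
rewrite Li_word_cons; last by rewrite /is_composition size_rev all_rev.
by rewrite [map _ _]/= /= IH//; elim: (a - 1) => //= n ->.
Qed.

Lemma size_Li_word k : is_composition k -> size (Li_word k) = sumn k.
Proof.
rewrite -(sumn_rev k) => /andP[_].
rewrite -all_rev /Li_word; elim: (rev k) => //= a l IH /andP[a0 /IH{}IH].
by rewrite size_cat size_nseq IH -addSn subn1 prednK.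
Qed.

(** The negated letters encode the reversal of k itself, so the letters as they stand have the
    complementary cuts; uniqueness of the Hoffman dual concludes. *)
Lemma hoffman_dual_Li_word k : is_composition k -> hoffman_dual (rev k) =
  composition_of_word (rcons (behead (Li_word k)) true).
Proof.
move=> kc; have kc' : is_composition (rev k).
  by rewrite /is_composition size_rev all_rev.
have w : (size (behead (Li_word k))).+1 = sumn (rev k).
  by rewrite sumn_rev -(size_Li_word kc) (Li_word_cons kc).
symmetry; apply: hoffman_dual_unique => //; first exact: composition_of_wordP.
  by rewrite sumn_composition_of_word.
move=> [|m] //= mw; rewrite mem_cuts_word.
rewrite -[in RHS](composition_of_Li_word kc') revK mem_cuts_word.
by rewrite (nth_map false) ?negbK // -ltnS w.
Qed.

Lemma count_Li_word k : count negb (Li_word k) = size k.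
Proof.
rewrite -(size_rev k) /Li_word; elim: (rev k) => //= a l IH.
by rewrite count_cat IH count_nseq mul0n.
Qed.

End Words.

(** * Star sums *)

Section StarSums.
Context {R : realType}.
Implicit Types (b : nat -> nat -> R) (l : seq nat).

(* Throughout, the index n stands for the integer n + 1. *)

Definition prefix_sum b n d : R := \sum_(p < n.+1) b p d.

(** On the generating function of b n d in x^d, this is multiplication by 1/(n + 1 - x). *)
Definition integrate_coef b n d : R :=
  \sum_(x < d.+1) b n (d - x)%N / n.+1%:R ^+ x.+1.

(** The support at n = 0 makes all prefix sums equal to 1 in degree d = 0, so the empty end of a
    chain is counted exactly once. As a series in t this is the single function e^(-t) t^m/m!. *)
Definition unit_coef (n d : nat) : R := ((n == 0) && (d == 0))%:R.

Definition letter_coef (c : bool) b : nat -> nat -> R :=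
  integrate_coef (if c then prefix_sum b else b).

(* star_coef l n d is the coefficient of x^d in the sum, over the chains
   n + 1 = n_1 >= ... >= n_r >= 1, of the product of the (n_i - x)^(-l_i). *)
Fixpoint star_coef l : nat -> nat -> R :=
  if l is a :: l' then fun n d =>
    \sum_(x < d.+1) 'C(a + x - 1, x)%:R / n.+1%:R ^+ (a + x) *
      prefix_sum (star_coef l') n (d - x)
  else unit_coef.

Fixpoint star_term l n : R :=
  if l is a :: l' then (n.+1%:R ^+ a)^-1 * \sum_(p < n.+1) star_term l' p
  else (n == 0)%:R.

(** Both sides run over the pairs with x + y <= d; on the right they are grouped by g = x + y. *)
Lemma sum_triangle (V : nmodType) (F : nat -> nat -> V) d :
  \sum_(x < d.+1) \sum_(y < (d - x).+1) F x y =
  \sum_(g < d.+1) \sum_(y < g.+1) F (g - y)%N y.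
Proof.
elim: d => [|d IH]; first by rewrite !big_ord1.
rewrite [RHS]big_ord_recr -IH [LHS]big_ord_recr /= subnn big_ord1.
(* Reversed, the antidiagonal x + y = d + 1 is indexed by x and supplies the last term of each inner
   sum on the left. *)
rewrite [\sum_(y < d.+2) _](reindex_inj rev_ord_inj)/= [X in _ = _ + X]big_ord_recr/=.
rewrite subnn subn0 addrA -big_split/=; congr (_ + _); apply: eq_bigr => x _.
have xd : (x <= d)%N by rewrite -ltnS.
by rewrite subSn// big_ord_recr/= !subSS -subSn// subKn// leqW.
Qed.

(** Hockey-stick identity. It includes a = 0, where the truncated 0 - 1 = 0 leaves only the term y =
    0. *)
Lemma sum_binomial_column a g :
  (\sum_(y < g.+1) 'C(a + y - 1, y) = 'C(a.+1 + g - 1, g))%N.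
Proof.
elim: g => [|g IH]; first by rewrite big_ord1 !bin0.
rewrite big_ord_recr /= IH.
have -> : (a.+1 + g - 1 = a + g)%N by lia.
have -> : (a + g.+1 - 1 = a + g)%N by lia.
have -> : (a.+1 + g.+1 - 1 = (a + g).+1)%N by lia.
by rewrite binS addnC.
Qed.

Lemma letter_coef_true b : letter_coef true b = integrate_coef (prefix_sum b).
Proof. by []. Qed.

(** The factor 1/(n + 1 - x) raises (n + 1 - x)^(-a) to the next exponent; on coefficients this is
    the hockey-stick identity. *)
Lemma integrate_star_coef a l :
  integrate_coef (star_coef (a :: l)) = star_coef (a.+1 :: l).
Proof.
apply/funext => n; apply/funext => d; rewrite /integrate_coef /=.
set P := prefix_sum _.
pose F x y := 'C(a + y - 1, y)%:R / n.+1%:R ^+ (a + y) * P n (d - (x + y))%N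
  / n.+1%:R ^+ x.+1.
transitivity (\sum_(x < d.+1) \sum_(y < (d - x).+1) F x y).
  by apply: eq_bigr => x _; rewrite mulr_suml; apply: eq_bigr => y _; rewrite /F subnDA.
rewrite sum_triangle; apply: eq_bigr => g _.
rewrite -sum_binomial_column natr_sum !mulr_suml; apply: eq_bigr => y _.
rewrite /F subnK; last by rewrite -ltnS.
have -> : (a.+1 + g = (a + y) + (g - y).+1)%N by have := ltn_ord y; lia.
by rewrite [in RHS]exprD invfM mulrAC !mulrA.
Qed.

Lemma letter_star_coef l :
  letter_coef true (star_coef l) = star_coef (1%N :: l).
Proof.
rewrite /letter_coef -integrate_star_coef; congr integrate_coef.
(* With leading exponent 0, the binomials C(x - 1, x) vanish for x > 0, and only the prefix sum
   remains. *)
apply/funext => n; apply/funext => d; rewrite /= big_ord_recl /= bin0 subn0.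
rewrite expr0 invr1 !mul1r big1 ?addr0// => x _.
by rewrite bin_small ?mul0r//= /bump; lia.
Qed.

(** The two cases of [composition_of_word] are the two rules just proved; the final [true] opens the
    innermost component. *)
Lemma star_coef_of_word v :
  foldr letter_coef unit_coef (rcons v true) =
  star_coef (composition_of_word (rcons v true)).
Proof.
elim: v => [|[] v IH] /=; first exact: (letter_star_coef [::]).
  by rewrite IH letter_star_coef.
rewrite IH; have [a [l ->]] := composition_of_word_cons v.
by rewrite /letter_coef integrate_star_coef.
Qed.

Lemma star_term_ge0 l n : 0 <= star_term l n.
Proof.
elim: l n => [|a l IH] n /=; first exact: ler0n.
by rewrite mulr_ge0// ?invr_ge0 ?exprn_ge0// sumr_ge0.
Qed.

Lemma sum_tuple_cons (V : nmodType) (T : finType) s (P : pred (seq T)) (F : seq T -> V) :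
  \sum_(j : s.+1.-tuple T | P j) F j =
  \sum_(x : T) \sum_(j : s.-tuple T | P (x :: j)) F (x :: j).
Proof.
rewrite pair_big_dep/= (reindex (fun p : T * s.-tuple T => cons_tuple p.1 p.2))/=.
  exact: eq_bigl.
exists (fun t => (thead t, behead_tuple t)) => [[x t] _|t _] /=.
  by congr pair; apply: val_inj.
by apply: val_inj; rewrite /= [in RHS](tuple_eta t).
Qed.

(** Multiplying out the binomial series of the factors (n_i - x)^(-l_i) distributes the degree d
    over the components. The bound m only makes the index type finite: entries of sum d <= m are at
    most m. *)
Lemma star_coefE m l n d : (d <= m)%N -> star_coef l n d =
  \sum_(j : (size l).-tuple 'I_m.+1 | sumn (map val j) == d)
     (B_coef l (map val j))%:R * star_term (add_seq l (map val j)) n.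
Proof.
elim: l n d => [|a l IH] n d dm.
  have E (j : 0.-tuple 'I_m.+1) : j = [tuple] by exact: tuple0.
  rewrite (eq_bigl (fun j => d == 0)); last by move=> j; rewrite (E j) eq_sym.
  rewrite -[LHS]/(unit_coef n d) /unit_coef andbC; case: (d == 0); last by rewrite big_pred0_eq.
  rewrite (big_pred1 [tuple]); last by move=> j; rewrite (E j); apply/esym/eqP.
  by rewrite /B_coef /= big_nil mul1r.
rewrite [size _]/= (sum_tuple_cons _ (fun j => sumn (map val j) == d)
  (fun j => (B_coef (a :: l) (map val j))%:R * star_term (add_seq (a :: l) (map val j)) n)).
rewrite [LHS]/= (big_ord_widen m.+1 (fun x => 'C(a + x - 1, x)%:R / n.+1%:R ^+ (a + x) *
      prefix_sum (star_coef l) n (d - x)))//.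
rewrite big_mkcond; apply: eq_bigr => x _; rewrite ltnS /=.
(* A first entry larger than d already exceeds the prescribed total. *)
case: leqP => xd; last first.
  by rewrite big_pred0// => j; rewrite gtn_eqF// (leq_trans xd)// leq_addr.
rewrite (eq_bigl (fun j : (size l).-tuple 'I_m.+1 => sumn (map val j) == d - x)%N); last first.
  by move=> j; rewrite -{1}(subnKC xd) eqn_add2l.
rewrite /prefix_sum mulr_sumr.
transitivity (\sum_(p < n.+1)
    \sum_(j : (size l).-tuple 'I_m.+1 | sumn (map val j) == (d - x)%N)
    'C(a + x - 1, x)%:R / n.+1%:R ^+ (a + x) *
    ((B_coef l (map val j))%:R * star_term (add_seq l (map val j)) p)).
  by apply: eq_bigr => p _; rewrite IH ?mulr_sumr// (leq_trans (leq_subr _ _)).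
rewrite exchange_big; apply: eq_bigr => j _.
rewrite /B_coef /= big_cons /= natrM !mulr_sumr; apply: eq_bigr => p _.
by ring.
Qed.

Local Notation zeta_term a n :=
  (\prod_(i < size a) ((tnth n i)%:R ^+ nth 0%N a i)^-1 : R).

(* The chains n_1 >= ... >= n_r, with n_1 ranging over the successors of Q. *)
Definition chains (Q : set nat) s : set (s.-tuple nat) :=
  [set n | (forall x, ohead n = Some x -> Q x.-1) /\ sorted geq n /\ all (leq 1) n]%classic.
Arguments chains : clear implicits.

(** For a positive first entry, having its predecessor below x means being at most x, so x can be
    put in front of the chain. *)
Lemma chains_ltP (x s : nat) (t : s.-tuple nat) :
  chains (`I_x)%classic s t <-> path geq x t && all (leq 1) t.
Proof.
case: s t => [|s] t; first by rewrite (tuple0 t).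
case/tupleP: t => y t; rewrite /chains /=; split.
  by move=> [/(_ y erefl) yx [-> /andP[y0 ->]]]; rewrite y0 !andbT; move: yx; case: y y0.
move=> /andP[/andP[yx yt] /andP[y0 t0]]; split; last by rewrite y0.
by move=> z [<-]; rewrite prednK.
Qed.

(** The first entry p + 1 is split off, and the rest is a chain bounded by p + 1, whose sum the
    hypothesis evaluates. The set Q is an initial segment in the induction and the whole of nat for
    [zeta_star]. *)
Lemma esum_chains (Q : set nat) a l (c : R) : 0 <= c ->
  (forall N (c' : R), (0 <= c')%R ->
    \esum_(n in chains (`I_N.+1)%classic (size l)) (c' * zeta_term l n)%R%:E =
    (c' * \sum_(p < N.+1) star_term l p)%R%:E)%E ->
  (\esum_(n in chains Q (size (a :: l))) (c * zeta_term (a :: l) n)%R%:E =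
   \esum_(p in Q) (c * star_term (a :: l) p)%R%:E)%E.
Proof.
move=> c0 IH.
rewrite (reindex_esum (Q `*`` (fun p => chains (`I_p.+1)%classic (size l))) _
    (fun q => cons_tuple q.1.+1 q.2)); last first.
  split.
  - move=> [p t] [/= Qp /chains_ltP /andP[pt at_]].
    by split => [x [<-]|].
  - move=> [p t] [p' t'] _ _ /= /(congr1 val) /= [-> tt'].
    by congr pair; apply: val_inj.
  - case/tupleP => x t /= [/(_ x erefl) Qx [/= st /andP[x0 at_]]].
    exists (x.-1, t) => /=; last by rewrite prednK.
    by split => //; apply/chains_ltP; rewrite prednK// st.
rewrite -(@esum_esum _ _ _ Q _ (fun p t => (c * zeta_term (a :: l) (cons_tuple p.+1 t))%R%:E)); last first.
  by move=> p t _ _; rewrite lee_fin mulr_ge0// prodr_ge0// => i _; rewrite invr_ge0 exprn_ge0.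
apply: eq_esum => p _.
(* The factor (p + 1)^(-a) of the first entry is absorbed into the constant c' of the hypothesis. *)
rewrite /= mulrA -IH ?mulr_ge0// ?invr_ge0 ?exprn_ge0//.
apply: eq_esum => t _; rewrite /= big_ord_recl /= mulrA; congr (_ * _)%:E.
by apply: eq_bigr => i _; rewrite tnthS.
Qed.

Lemma esum_chains_lt l N (c : R) : 0 <= c ->
  (\esum_(n in chains (`I_N.+1)%classic (size l)) (c * zeta_term l n)%R%:E =
   (c * \sum_(p < N.+1) star_term l p)%R%:E)%E.
Proof.
elim: l N c => [|a l IH] N c c0.
  rewrite (_ : chains _ _ = [set [tuple]])%classic; last first.
    apply/seteqP; split => t /=; first by rewrite (tuple0 t).
    by move=> ->.
  rewrite esum_set1 ?big_ord0 ?mulr1 ?lee_fin// big_ord_recl/= big1 ?addr0 ?mulr1//.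
rewrite esum_chains// esum_fset//; last first.
  by move=> i _; rewrite lee_fin mulr_ge0// star_term_ge0.
by rewrite -fsbig_ord sumEFin mulr_sumr.
Qed.

Lemma zeta_starE a l :
  (zeta_star R (a :: l) = \sum_(n <oo) (star_term (a :: l) n)%:E)%E.
Proof.
rewrite nneseries_esumT; last by move=> n; rewrite lee_fin star_term_ge0.
rewrite -(eq_esum (fun n _ => congr1 EFin (mul1r (star_term (a :: l) n)))).
rewrite -esum_chains//; last by move=> N c c0; rewrite esum_chains_lt.
rewrite /zeta_star (_ : [set n | _]%classic = chains setT _).
  by apply: eq_esum => n _; rewrite mul1r.
by apply/seteqP; split => t /=; [move=> /andP[]|move=> [_ [-> ->]]].
Qed.

End StarSums.

(** * Exponential polynomials *)

Section ExponentialTails.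
Context {R : realType}.
Local Open Scope classical_set_scope.
Implicit Types (n i : nat) (t : R).
Local Notation mu := (@lebesgue_measure R).

Definition exp_monomial n i t : R :=
  expR (- (n.+1%:R * t)) * (t ^+ i / i`!%:R).

(** The integral of [exp_monomial n i] from t to infinity, in the closed form given by repeated
    integration by parts. *)
Definition exp_monomial_tail n i t : R :=
  \sum_(x < i.+1) exp_monomial n (i - x) t / n.+1%:R ^+ x.+1.

Lemma exp_monomial_ge0 n i t : 0 <= t -> 0 <= exp_monomial n i t.
Proof. by move=> t0; rewrite mulr_ge0 ?expR_ge0// divr_ge0// exprn_ge0. Qed.

Lemma exp_monomial_tailS n i t : exp_monomial_tail n i.+1 t =
  (exp_monomial n i.+1 t + exp_monomial_tail n i t) / n.+1%:R.
Proof.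
rewrite /exp_monomial_tail big_ord_recl subn0 expr1 mulrDl; congr (_ + _).
rewrite mulr_suml; apply: eq_bigr => x _.
by rewrite /= /bump /= add1n subSS [in LHS]exprSr invfM mulrA.
Qed.

Lemma is_derive_mulcl (f : R -> R) (k x df : R) :
  is_derive x 1 f df -> is_derive x 1 (fun t => k * f t) (k * df).
Proof. exact: is_deriveZ. Qed.

Lemma is_derive_exp_monomial n i t : is_derive t 1 (exp_monomial n i)
  ((if i is i'.+1 then exp_monomial n i' t else 0) - n.+1%:R * exp_monomial n i t).
Proof.
set c := n.+1%:R.
have dE : is_derive t 1 (fun t : R => expR (- (c * t))) (- c * expR (- (c * t))).
  have H : is_derive t 1 (fun t : R => - c * t) (- c).
    have := @is_derive_mulcl id (- c) t _ (is_derive_id t 1).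
    by rewrite mulr1.
  have := @is_derive1_comp _ expR _ t _ _ (is_derive_expR _) H.
  rewrite /= mulrC mulNr; congr (is_derive _ _ _ _); last by rewrite !mulNr.
  by apply/funext => x /=; rewrite mulNr.
have dM : is_derive t 1 (fun t : R => t ^+ i / i`!%:R)
   (if i is i'.+1 then t ^+ i' / i'`!%:R else 0).
  have := is_derive_mulcl i`!%:R^-1 (is_deriveX i (is_derive_id t 1)).
  rewrite [X in is_derive _ _ X _](_ : _ = fun t => t ^+ i / i`!%:R); last first.
    by apply/funext => x; rewrite mulrC exprfctE.
  rewrite /GRing.scale/= mulr1; case: (i) => [|j] /=; first by rewrite mul0r mulr0.
  move=> dX; apply: (is_derive_eq dX); rewrite factS natrM.
  have h1 : (1 + j%:R : R) != 0 by rewrite nat1r pnatr_eq0.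
  have h2 : (j`!%:R : R) != 0 by rewrite pnatr_eq0 -lt0n fact_gt0.
  by field; rewrite h2.
have := is_deriveM dE dM.
congr (is_derive _ _ _ _).
rewrite /GRing.scale/= /exp_monomial -/c.
by case: i {dM} => [|i]; ring.
Qed.

(** In the recursion [exp_monomial_tailS], the term produced by differentiating the power of t
    cancels against the derivative of the preceding tail. *)
Lemma is_derive_exp_monomial_tail n i t :
  is_derive t 1 (exp_monomial_tail n i) (- exp_monomial n i t).
Proof.
have c0 : (n.+1%:R : R) != 0 by rewrite pnatr_eq0.
elim: i => [|i IH].
  rewrite (_ : exp_monomial_tail n 0 = fun t => n.+1%:R^-1 * exp_monomial n 0 t); last first.
    by apply/funext => x; rewrite /exp_monomial_tail big_ord1 subn0 mulrC.
  have := is_derive_mulcl n.+1%:R^-1 (is_derive_exp_monomial n 0 t).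
  by rewrite sub0r mulrN mulKf.
rewrite (_ : exp_monomial_tail n i.+1 =
    fun t => n.+1%:R^-1 * (exp_monomial n i.+1 t + exp_monomial_tail n i t)); last first.
  by apply/funext => x; rewrite exp_monomial_tailS mulrC.
have := is_derive_mulcl n.+1%:R^-1 (is_deriveD (is_derive_exp_monomial n i.+1 t) IH).
by rewrite addrAC subrr add0r mulrN mulKf.
Qed.

Lemma continuous_exp_monomial n i : continuous (exp_monomial n i).
Proof.
move=> t; apply/differentiable_continuous/derivable1_diffP.
by have [] := is_derive_exp_monomial n i t.
Qed.

(** Since e^t >= t^(i+1)/(i+1)!, the monomial is at most (i + 1)/t for t > 0. *)
Lemma cvg_exp_monomial n i : exp_monomial n i t @[t --> +oo%R] --> 0.
Proof.
apply: (@squeeze_cvgr _ _ _ _ (fun=> 0) (fun t => i.+1%:R * t^-1)); last 2 first.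
- exact: cvg_cst.
- rewrite -[X in _ --> X](mulr0 i.+1%:R); apply: cvgMr.
  by apply/(@gtr0_cvgV0 _ _ _ _ id); [exact: nbhs_pinfty_gt|exact: cvg_id].
near=> t; have t0 : 0 < t by near: t; exact: nbhs_pinfty_gt.
rewrite exp_monomial_ge0 ?(ltW t0)//= /exp_monomial.
rewrite (@le_trans _ _ (expR (- t) * (t ^+ i / i`!%:R)))//.
  rewrite ler_wpM2r ?divr_ge0 ?exprn_ge0 ?(ltW t0)//.
  by rewrite ler_expR lerN2 ler_peMl ?(ltW t0)// ler1n.
have := @expR_ge1Dxn R t i (ltW t0) => /(le_trans _) H.
have {H} : t ^+ i.+1 / (i.+1)`!%:R <= expR t by apply: H; rewrite lerDr.
rewrite expRN factS natrM exprS => H.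
rewrite mulrC ler_pdivrMr ?expR_gt0//.
have h1 : (1 + i%:R : R) != 0 by rewrite nat1r pnatr_eq0.
have h2 : (i`!%:R : R) != 0 by rewrite pnatr_eq0 -lt0n fact_gt0.
have -> : t ^+ i / i`!%:R = i.+1%:R / t * (t * t ^+ i / (i.+1%:R * i`!%:R)).
  by field; rewrite h2 h1 gt_eqF.
by apply: ler_wpM2l => //; rewrite divr_ge0// ltW.
Unshelve. all: by end_near. Qed.

Lemma cvg_exp_monomial_tail n i : exp_monomial_tail n i t @[t --> +oo%R] --> 0.
Proof.
elim: i => [|i IH].
  rewrite (_ : exp_monomial_tail n 0 = fun t => exp_monomial n 0 t / n.+1%:R); last first.
    by apply/funext => x; rewrite /exp_monomial_tail big_ord1 subn0.
  by rewrite -[X in _ --> X](mul0r n.+1%:R^-1); apply: cvgMl; exact: cvg_exp_monomial.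
rewrite (_ : exp_monomial_tail n i.+1 =
    fun t => (exp_monomial n i.+1 t + exp_monomial_tail n i t) / n.+1%:R); last first.
  by apply/funext => x; rewrite exp_monomial_tailS.
rewrite -[X in _ --> X](mul0r n.+1%:R^-1); apply: cvgMl.
by rewrite -[X in _ --> X](addr0 0); apply: cvgD => //; exact: cvg_exp_monomial.
Qed.

(** The function -tail(phi q) is an antiderivative that vanishes at infinity, so the fundamental
    theorem on a half-line applies. It is used for phi q = q and for phi q = ln (1 + q). *)
Lemma integral_exp_monomial_comp (phi psi : R -> R) n i (a : R) : 0 <= a ->
  (forall q : R, 0 <= q -> is_derive q 1 phi (psi q)) ->
  (forall q : R, 0 <= q -> {for q, continuous psi}) ->
  (forall q : R, 0 <= q -> 0 <= psi q) -> (forall q : R, 0 <= q -> 0 <= phi q) ->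
  phi q @[q --> +oo%R] --> +oo%R ->
  (\int[mu]_(q in `[a, +oo[) (exp_monomial n i (phi q) * psi q)%:E =
   (exp_monomial_tail n i (phi a))%:E)%E.
Proof.
move=> a0 dphi cpsi psi0 phi0 phioo.
have dF (q : R) : 0 <= q ->
    is_derive q 1 (fun q => - exp_monomial_tail n i (phi q)) (exp_monomial n i (phi q) * psi q).
  move=> q0; have h := dphi _ q0.
  have := @is_derive1_comp _ (exp_monomial_tail n i) phi q _ _ (is_derive_exp_monomial_tail n i (phi q)) h.
  move=> h2; apply: is_derive_eq; rewrite ?mulNr ?opprK//.
rewrite (@ge0_continuous_FTC2y _ _ (fun q => - exp_monomial_tail n i (phi q)) _ 0).
- by rewrite sub0e EFinN oppeK.
- move=> x ax; have x0 := le_trans a0 ax.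
  by rewrite mulr_ge0 ?exp_monomial_ge0 ?psi0 ?phi0.
- apply: continuous_in_subspaceT => x; rewrite inE/= in_itv/= andbT => ax.
  have x0 := le_trans a0 ax.
  apply: cvgM; last exact: cpsi.
  apply: continuous_comp; last exact: continuous_exp_monomial.
  apply/differentiable_continuous/derivable1_diffP.
  by have [] := dphi _ x0.
- rewrite -oppr0; apply: cvgN.
  exact: (cvg_comp _ _ phioo (@cvg_exp_monomial_tail n i)).
- by move=> x ax; have [] := dF _ (le_trans a0 (ltW ax)).
- apply: cvg_at_right_filter.
  have [+ _] := dF _ a0; move=> /derivable1_diffP /differentiable_continuous.
  exact.
- move=> x; rewrite in_itv/= andbT => ax.
  by rewrite derive1E; have [_ ->] := dF _ (le_trans a0 (ltW ax)).
Qed.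

End ExponentialTails.

(** * Series of exponential monomials and their integrals *)

Section ExponentialSeries.
Context {R : realType}.
Local Open Scope classical_set_scope.
Implicit Types (n i m : nat) (t : R) (b : nat -> nat -> R).
Local Notation mu := (@lebesgue_measure R).

Lemma measurable_exp_monomial n i : measurable_fun [set: R] (exp_monomial n i : R -> R).
Proof. by apply: continuous_measurable_fun; exact: continuous_exp_monomial. Qed.

Definition abs_letter (c : bool) (s : R) : R := if c then (- s)^-1 else (1 - s)^-1.

Lemma measurable_abs_letter c :
  measurable_fun (`]-oo, 0[ : set R) (abs_letter c).
Proof.
apply: open_continuous_measurable_fun; first exact: interval_open.
move=> s; rewrite inE/= in_itv/= => s0.
have cN : {for s, continuous (fun s : R => - s)} by apply: cvgN; exact: cvg_id.
case: c; apply: cvgV => //; first by rewrite oppr_eq0 lt_eqF.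
  by rewrite gt_eqF// subr_gt0 (lt_trans s0).
by apply: cvgD => //; exact: cvg_cst.
Qed.

Lemma integral_exp_monomial n i (a : R) : 0 <= a ->
  (\int[mu]_(t in `]a, +oo[) (exp_monomial n i t)%:E = (exp_monomial_tail n i a)%:E)%E.
Proof.
move=> a0; have <- : (\int[mu]_(t in `[a, +oo[) (exp_monomial n i (id t) * 1)%R%:E =
    (exp_monomial_tail n i (id a))%:E)%E.
  apply: (@integral_exp_monomial_comp _ id (cst 1)) => //.
  by move=> q _; exact: cvg_cst.
under [in RHS]eq_integral do rewrite mulr1.
rewrite integral_itv_obnd_cbnd//.
apply/measurable_EFinP; apply: measurable_funTS; exact: measurable_exp_monomial.
Qed.

(** The substitution s = -q followed by t = ln (1 + q), with dt = dq/(1 + q), turns the integral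
    into a tail starting at ln (1 - z). *)
Lemma integral_exp_monomial_ln n i (z : R) : z <= 0 ->
  (\int[mu]_(s in `]-oo, z[) (exp_monomial n i (ln (1 - s)) * (1 - s)^-1)%:E =
   (exp_monomial_tail n i (ln (1 - z)))%:E)%E.
Proof.
move=> z0; have Nz0 : 0 <= - z by rewrite oppr_ge0.
have pos (q : R) : 0 <= q -> 0 < 1 + q by move=> q0; rewrite ltr_pwDl.
rewrite integral_itv_bndo_bndc; last first.
  apply/measurable_EFinP; apply: measurable_funM.
    apply: measurable_funTS; apply: measurableT_comp; first exact: measurable_exp_monomial.
    by apply: measurableT_comp; [exact: measurable_ln|exact: measurable_funB].
  apply: (measurable_funS _ _ (measurable_abs_letter false)) => //.
  by move=> s /=; rewrite !in_itv/= => /lt_le_trans; apply.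
have -> : z = - (- z) by rewrite opprK.
have der (q : R) : 0 <= q -> is_derive q 1 (fun q => ln (1 + q)) (1 + q)^-1.
  move=> q0.
  have h1 : is_derive q 1 (fun q : R => 1 + q) 1.
    by have := is_deriveD (is_derive_cst (1 : R) q 1) (is_derive_id q 1); rewrite add0r.
  have := @is_derive1_comp _ (@ln R) (fun q => 1 + q) q _ _ (is_derive1_ln (pos _ q0)) h1.
  by rewrite mulr1.
have cinv (q : R) : 0 <= q -> {for q, continuous (fun q : R => (1 + q)^-1)}.
  move=> q0; apply: cvgV; first by rewrite gt_eqF// pos.
  by apply: cvgD; [exact: cvg_cst|exact: cvg_id].
rewrite (ge0_integration_by_substitutionNy (G := fun s => exp_monomial n i (ln (1 - s)) * (1 - s)^-1)); last 2 first.
- apply: continuous_in_subspaceT => s; rewrite inE/= in_itv/= opprK => sz.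
  have s0 : 0 <= - s by rewrite oppr_ge0 (le_trans sz).
  have cN : {for s, continuous (fun s : R => - s)} by apply: cvgN; exact: cvg_id.
  apply: cvgM; last exact: (@continuous_comp _ _ _ (fun s : R => - s) (fun q => (1 + q)^-1) s cN (cinv _ s0)).
  apply: (@continuous_comp _ _ _ (fun s : R => - s) (fun q => exp_monomial n i (ln (1 + q))) s cN).
  apply: (@continuous_comp _ _ _ (fun q : R => ln (1 + q)) (exp_monomial n i)); last exact: continuous_exp_monomial.
  apply/differentiable_continuous/derivable1_diffP.
  by have [] := der _ s0.
- move=> s; rewrite in_itv/= opprK => sz; have s0 : s <= 0 by rewrite (le_trans (ltW sz)).
  by rewrite mulr_ge0 ?invr_ge0 ?exp_monomial_ge0 ?ln_ge0 ?subr_ge0 ?lerBrDr ?(le_trans s0)// gerDl.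
rewrite opprK -(@integral_exp_monomial_comp _ (fun q => ln (1 + q)) (fun q => (1 + q)^-1) n i (- z))//.
- by apply: eq_integral => q _ /=; rewrite opprK.
- by move=> q q0; rewrite invr_ge0 ltW// pos.
- by move=> q q0; rewrite ln_ge0// lerDl.
(* It suffices that q >= e^A. *)
- apply/cvgryPge => A; near=> q.
  have q0 : 0 < q by near: q; exact: nbhs_pinfty_gt.
  rewrite -ler_expR lnK ?posrE ?addr_gt0//.
  apply: (@le_trans _ _ q); last by rewrite lerDr.
  by near: q; apply: nbhs_pinfty_ge; exact: num_real.
Unshelve. all: by end_near. Qed.

(** Here m is the initial degree in t and d counts the powers of t used up by integrations. The
    values lie in the extended reals, so no convergence has to be proved. *)
Definition exp_series m b t : \bar R :=
  (\sum_(n <oo) (\sum_(d < m.+1) b n d * exp_monomial n (m - d) t)%R%:E)%E.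

Definition coef_ge0 b := forall n d, 0 <= b n d.

Lemma exp_coef_ge0 m b n t : coef_ge0 b -> 0 <= t ->
  0 <= \sum_(d < m.+1) b n d * exp_monomial n (m - d) t.
Proof. by move=> b0 t0; apply: sumr_ge0 => d _; rewrite mulr_ge0 ?exp_monomial_ge0. Qed.

Lemma exp_series_ge0 m b t : coef_ge0 b -> 0 <= t -> (0 <= exp_series m b t)%E.
Proof. by move=> b0 t0; apply: nneseries_ge0 => n _ _; rewrite lee_fin exp_coef_ge0. Qed.

(** At t = 0 every monomial of positive degree vanishes, which leaves d = m. *)
Lemma exp_series0 m b : coef_ge0 b ->
  exp_series m b 0 = (\sum_(n <oo) (b n m)%:E)%E.
Proof.
move=> b0; apply: eq_eseriesr => n _; congr EFin.
rewrite big_ord_recr /= subnn big1 ?add0r; last first.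
  by move=> [d dm] _ /=; rewrite /exp_monomial -(@prednK (m - d)) ?subn_gt0// exprS !mul0r !mulr0.
by rewrite /exp_monomial mulr0 oppr0 expR0 fact0 invr1 expr0 !mulr1.
Qed.

Lemma prefix_sum_ge0 b : coef_ge0 b -> coef_ge0 (prefix_sum b).
Proof. by move=> b0 n d; apply: sumr_ge0. Qed.

Lemma integrate_coef_ge0 b : coef_ge0 b -> coef_ge0 (integrate_coef b).
Proof. by move=> b0 n d; apply: sumr_ge0 => x _; rewrite divr_ge0// exprn_ge0. Qed.

Lemma letter_coef_ge0 c b : coef_ge0 b -> coef_ge0 (letter_coef c b).
Proof. by case: c => b0; apply: integrate_coef_ge0 => //; apply: prefix_sum_ge0. Qed.

Lemma geometric_expR t : 0 < t ->
  (((1 - expR (- t))^-1)%:E = \sum_(p <oo) (expR (- (p%:R * t)))%:E)%E.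
Proof.
move=> t0; have e1 : `|expR (- t)| < 1.
  by rewrite ger0_norm ?expR_ge0// expR_lt1 oppr_lt0.
have H := @cvg_geometric_series R 1 _ e1.
rewrite -div1r -(cvg_lim _ H)// -EFin_lim; last by apply/cvg_ex; exists (1 / (1 - expR (- t))).
congr (limn _); apply/funext => n; rewrite sumEFin; congr EFin.
by apply: eq_bigr => p _; rewrite /= mul1r -expRM_natl mulrN.
Qed.

Lemma exp_monomial_shift n p i t :
  exp_monomial (p + n) i t = expR (- (p%:R * t)) * exp_monomial n i t.
Proof.
rewrite /exp_monomial [RHS]mulrA -expRD; congr (expR _ * _).
by rewrite -addnS natrD mulrDl opprD.
Qed.

(** Multiplying by the geometric series of e^(-t) moves the coefficient at n to all indices n + p;
    collecting by N = n + p gives the prefix sums. *)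
Lemma exp_series_prefix_sum m b t : coef_ge0 b -> 0 < t ->
  exp_series m (prefix_sum b) t = (((1 - expR (- t))^-1)%:E * exp_series m b t)%E.
Proof.
move=> b0 t0.
pose a n N := \sum_(d < m.+1) b n d * exp_monomial N (m - d) t.
have a0 n N : 0 <= a n N.
  by apply: sumr_ge0 => d _; rewrite mulr_ge0 ?exp_monomial_ge0// ltW.
(* The condition n <= N becomes a case distinction, so that the nonnegative double series can be
   interchanged. *)
transitivity (\sum_(N <oo) \sum_(n <oo) if (n <= N)%N then (a n N)%:E else 0)%E.
  apply: eq_eseriesr => N _; rewrite (nneseries_split _ N.+1); last first.
    by move=> n _; case: ifP => _ //; rewrite lee_fin.
  rewrite [X in (_ + X)%E]eseries0 ?adde0; last first.
    by move=> n nN _; rewrite leqNgt nN.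
  rewrite big_mkord (eq_bigr (fun n : 'I_N.+1 => (a n N)%:E)); last first.
    by move=> n _; rewrite -ltnS ltn_ord.
  rewrite sumEFin; congr EFin; rewrite /a exchange_big; apply: eq_bigr => d _.
  by rewrite mulr_suml.
rewrite nneseries_interchange; last first.
  by move=> n N; case: ifP => _ //; rewrite lee_fin.
rewrite -nneseriesZl; last by move=> n _; rewrite lee_fin a0.
apply: eq_eseriesr => n _.
rewrite geometric_expR// muleC -nneseriesZl; last by move=> p _; rewrite lee_fin expR_ge0.
rewrite (nneseries_split _ n); last by move=> N _; case: ifP => _ //; rewrite lee_fin.
rewrite add0n big_nat big1 ?add0e; last first.
  by move=> N /andP[_ Nn]; rewrite leqNgt Nn.
(* From here on N = p + n. *)
rewrite -nneseries_addn; last by move=> N; case: ifP => _ //; rewrite lee_fin.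
apply: eq_eseriesr => p _; rewrite leq_addl -EFinM; congr EFin.
rewrite mulr_suml; apply: eq_bigr => d _.
by rewrite exp_monomial_shift -mulrA; congr (_ * _); rewrite mulrC.
Qed.

Lemma sum_tail_integrate m b n t :
  \sum_(d < m.+1) b n d * exp_monomial_tail n (m - d) t =
  \sum_(d < m.+1) integrate_coef b n d * exp_monomial n (m - d) t.
Proof.
pose F d x := b n d * exp_monomial n (m - (d + x)) t / n.+1%:R ^+ x.+1.
transitivity (\sum_(d < m.+1) \sum_(x < (m - d).+1) F d x).
  apply: eq_bigr => d _; rewrite mulr_sumr; apply: eq_bigr => x _.
  by rewrite /F subnDA mulrA.
rewrite sum_triangle; apply: eq_bigr => d _.
rewrite mulr_suml; apply: eq_bigr => x _; rewrite /F subnK; last by rewrite -ltnS.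
by rewrite mulrAC.
Qed.

(** By nonnegativity the series is integrated term by term. The pair (theta, rho) is either (t, 1)
    or (ln (1 - s), 1/(1 - s)), and T is the value of theta at the finite end of D. *)
Lemma integral_exp_series (D : set R) (theta rho : R -> R) T m b :
  measurable D -> measurable_fun D theta -> measurable_fun D rho ->
  coef_ge0 b -> (forall s, D s -> 0 <= theta s) -> (forall s, D s -> 0 <= rho s) ->
  (forall n i, \int[mu]_(s in D) (exp_monomial n i (theta s) * rho s)%R%:E =
               (exp_monomial_tail n i T)%:E)%E ->
  (\int[mu]_(s in D) (exp_series m b (theta s) * (rho s)%:E) =
   exp_series m (integrate_coef b) T)%E.
Proof.
move=> mD mtheta mrho b0 theta0 rho0 tail.
have mE n i : measurable_fun D (fun s => exp_monomial n i (theta s) * rho s).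
  apply: measurable_funM => //; apply: measurableT_comp => //.
  exact: measurable_exp_monomial.
have E0 n i s : D s -> 0 <= exp_monomial n i (theta s) * rho s.
  by move=> Ds; rewrite mulr_ge0 ?rho0// exp_monomial_ge0// theta0.
have mEs n : measurable_fun D (fun s => \sum_(d < m.+1)
    b n d * (exp_monomial n (m - d) (theta s) * rho s)).
  apply: measurable_sum => d; apply: measurable_funM => //; exact: mE.
transitivity (\int[mu]_(s in D) \sum_(n <oo) (\sum_(d < m.+1)
    b n d * (exp_monomial n (m - d) (theta s) * rho s))%R%:E)%E.
  apply: eq_integral => s; rewrite inE => Ds; rewrite muleC -nneseriesZl; last first.
    by move=> n _; rewrite lee_fin exp_coef_ge0// theta0.
  apply: eq_eseriesr => n _; rewrite -EFinM; congr EFin.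
  by rewrite mulr_sumr; apply: eq_bigr => d _; rewrite mulrC mulrA.
rewrite integral_nneseries//; last 2 first.
- by move=> n; apply/measurable_EFinP; exact: mEs.
- move=> n s Ds; rewrite lee_fin sumr_ge0// => d _.
  by rewrite mulr_ge0// E0.
apply: eq_eseriesr => n _; rewrite -sum_tail_integrate.
under eq_integral do rewrite -sumEFin.
rewrite ge0_integral_sum//; last 2 first.
- by move=> d; apply/measurable_EFinP; apply: measurable_funM => //; exact: mE.
- move=> d s Ds; rewrite lee_fin.
  by rewrite mulr_ge0// E0.
rewrite -sumEFin; apply: eq_bigr => d _.
under eq_integral do rewrite EFinM.
rewrite ge0_integralZl ?tail ?lee_fin//; first by apply/measurable_EFinP; exact: mE.
by move=> s Ds; rewrite lee_fin E0.
Qed.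

Lemma measurable_exp_series m b (D : set R) (theta : R -> R) :
  measurable D -> measurable_fun D theta -> coef_ge0 b ->
  (forall s, D s -> 0 <= theta s) ->
  measurable_fun D (fun s => exp_series m b (theta s)).
Proof.
move=> mD mtheta b0 theta0.
apply: (@ge0_emeasurable_sum _ _ _ D (fun n s => (\sum_(d < m.+1) b n d * exp_monomial n (m - d) (theta s))%R%:E) xpredT).
  by move=> n s Ds _; rewrite lee_fin exp_coef_ge0// theta0.
move=> n _; apply/measurable_EFinP.
apply: measurable_sum => d; apply: measurable_funM => //.
by apply: measurableT_comp => //; exact: measurable_exp_monomial.
Qed.

End ExponentialSeries.

(** * Iterated integrals on the negative axis *)

Section IteratedIntegrals.
Context {R : realType}.
Local Open Scope classical_set_scope.
Local Notation mu := (@lebesgue_measure R).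
Local Notation neg := (`]-oo, 0[ : set R).
Implicit Types (c : bool) (w : seq bool).

(** Both sides integrate g(t) h(s) over the region t in D, phi t < s < 0; extension by zero and the
    indicator of phi t < s reduce this to Tonelli on the plane. It serves phi t = t between
    consecutive letters and phi t = 1 - e^t for the kernel of eta. *)
Lemma tonelli_triangle (D : set R) (phi : R -> R) (g h : R -> \bar R) :
  measurable D -> measurable_fun setT phi ->
  measurable_fun D g -> measurable_fun neg h ->
  (forall t, D t -> (0 <= g t)%E) -> (forall s, neg s -> (0 <= h s)%E) ->
  (\int[mu]_(t in D) (g t * \int[mu]_(s in `]phi t, 0%R[) h s) =
   \int[mu]_(s in neg) (h s * \int[mu]_(t in D `&` [set t | (phi t < s)%R]) g t))%E.
Proof.
move=> mD mphi mg mh g0 h0.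
pose f (p : R * R) : \bar R :=
  ((g \_ D) p.1 * ((h \_ neg) p.2 * ((phi p.1 < p.2)%R%:R)%:E))%E.
have gD0 t : (0 <= (g \_ D) t)%E by rewrite /patch; case: ifP => // /set_mem /g0.
have hD0 s : (0 <= (h \_ neg) s)%E by rewrite /patch; case: ifP => // /set_mem /h0.
have f0 p : (0 <= f p)%E by rewrite !mule_ge0// lee_fin ler0n.
have mgD : measurable_fun setT (g \_ D) by apply/(measurable_restrictT _ _).1.
have mhD : measurable_fun setT (h \_ neg) by apply/(measurable_restrictT _ _).1.
have mI : measurable_fun setT (fun p : R * R => ((phi p.1 < p.2)%R%:R)%:E : \bar R).
  apply/measurable_EFinP; apply: measurableT_comp => //.
    apply: measurable_fun_ltr => //.
    exact: measurableT_comp.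
have mf : measurable_fun setT f.
  by apply: emeasurable_funM; [exact: measurableT_comp|
    apply: emeasurable_funM => //; exact: measurableT_comp].
transitivity (\int[mu]_t \int[mu]_s f (t, s))%E.
  rewrite integral_mkcond; apply: eq_integral => t _.
  rewrite /f /= ge0_integralZl//; last 2 first.
  - by apply: emeasurable_funM => //; apply/measurable_EFinP; apply: measurableT_comp => //; exact: measurable_fun_ltr.
  - by move=> s _; rewrite mule_ge0// lee_fin ler0n.
  rewrite {1 2}/patch; case: ifP => tD; last by rewrite mul0e.
  congr (_ * _)%E; rewrite [LHS]integral_mkcond; apply: eq_integral => s _.
  have sE : (s \in `]phi t, 0[) = (phi t < s) && (s \in neg).
    apply/idP/andP => [|[ts]]; rewrite !inE /= !in_itv/=; last by rewrite ts.
    by move=> /andP[-> ->].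
  rewrite /patch sE; case: (s \in neg); case: (phi t < s) => /=;
    by rewrite ?mule1 ?mule0 ?mul0e.
rewrite fubini_tonelli//.
rewrite [RHS]integral_mkcond; apply: eq_integral => s _.
rewrite /f /=.
under eq_integral do rewrite muleCA.
rewrite ge0_integralZl//; last 2 first.
- by apply: emeasurable_funM => //; apply/measurable_EFinP; apply: measurableT_comp => //; exact: measurable_fun_ltr.
- by move=> t _; rewrite mule_ge0// lee_fin ler0n.
rewrite {1 3}/patch; case: ifP => sD; last by rewrite mul0e.
congr (_ * _)%E; rewrite [RHS]integral_mkcond; apply: eq_integral => t _.
rewrite /patch in_setI /=.
have -> : (t \in [set t | phi t < s]) = (phi t < s) by apply/idP/idP; rewrite inE.
by case: (t \in D); case: (phi t < s); rewrite ?mule1 ?mule0 ?mul0e.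
Qed.

(* For z < 0, the absolute value of the iterated integral from 0 to z of the
   forms in w. *)
Definition abs_iterated w : R -> R :=
  foldl (fun F c z => \int[mu]_(t in `]z, 0[) (F t * abs_letter c t)) (fun=> 1) w.

Lemma abs_iterated_rcons w c z : abs_iterated (rcons w c) z =
  \int[mu]_(t in `]z, 0[) (abs_iterated w t * abs_letter c t).
Proof. by rewrite /abs_iterated foldl_rcons. Qed.

Lemma abs_letter_ge0 c s : neg s -> 0 <= abs_letter c s.
Proof.
rewrite /= in_itv/= => s0; case: c; rewrite /= invr_ge0; first by rewrite oppr_ge0 ltW.
by rewrite subr_ge0 (le_trans (ltW s0)).
Qed.

Lemma abs_letter_le c s : neg s -> abs_letter c s <= (- s)^-1.
Proof.
rewrite /= in_itv/= => s0; case: c => //=.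
by rewrite lef_pV2 ?posrE ?oppr_gt0 ?subr_gt0 ?(lt_trans s0 ltr01)// lerDr.
Qed.

(** The bound 1 makes h integrable on each bounded interval ]z, 0[, so its real-valued integral
    agrees with the extended one used in Tonelli's theorem. *)
Definition subunit (h : R -> R) := measurable_fun neg h /\ forall t, neg t -> 0 <= h t <= 1.

Lemma subset_neg z : `]z, 0[ `<=` neg.
Proof. by move=> t /=; rewrite !in_itv/= => /andP[]. Qed.

Lemma integrable_subunit h (z : R) : subunit h -> mu.-integrable `]z, 0[ (EFin \o h).
Proof.
move=> [mh h01]; apply: measurable_bounded_integrable => //=.
- rewrite lebesgue_measure_itv/=; case: ifPn => // _; by rewrite -EFinB ltry.
- by apply: measurable_funS mh => //; exact: subset_neg.
- exists 1; split; first exact: num_real.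
  move=> x x1 t /= tz; have /andP[h0 h1] := h01 t (subset_neg tz).
  by rewrite ger0_norm// (le_trans h1)// ltW.
Qed.

Lemma Rintegral_subunitE h (z : R) : subunit h ->
  ((\int[mu]_(t in `]z, 0%R[) h t)%R%:E = \int[mu]_(t in `]z, 0%R[) (h t)%:E)%E.
Proof.
move=> hs; rewrite /Rintegral fineK//; exact: integrable_fin_num (integrable_subunit z hs).
Qed.

Lemma Rintegral_subunit_ge0 h z : subunit h -> 0 <= \int[mu]_(t in `]z, 0[) h t.
Proof.
by move=> [_ h01]; apply: Rintegral_ge0 => t /subset_neg /h01 /andP[].
Qed.

Lemma Rintegral_subunit_le h (z : R) : subunit h -> z < 0 -> \int[mu]_(t in `]z, 0[) h t <= - z.
Proof.
move=> hs z0; have [mh h01] := hs.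
rewrite -lee_fin Rintegral_subunitE//.
apply: (@le_trans _ _ (\int[mu]_(t in `]z, 0%R[) (1%:E))%E).
  apply: ge0_le_integral => //=.
  - by move=> t /subset_neg /h01 /andP[h0 _]; rewrite lee_fin.
  - by apply/measurable_EFinP; apply: measurable_funS mh => //; exact: subset_neg.
  - by move=> t /subset_neg /h01 /andP[_ h1]; rewrite lee_fin.
by rewrite integral_cst//= lebesgue_measure_itv/= lte_fin z0 mul1e -EFinB sub0r.
Qed.

(** The integral is nonincreasing in z because h is nonnegative, and monotone functions are
    measurable. *)
Lemma measurable_Rintegral_subunit h : subunit h ->
  measurable_fun setT (fun z : R => \int[mu]_(t in `]z, (0 : R)[) h t).
Proof.
move=> hs; have [mh h01] := hs; apply: nonincreasing_measurable => // x y xy.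
rewrite -lee_fin !Rintegral_subunitE//; apply: ge0_subset_integral => //.
- by apply/measurable_EFinP; apply: measurable_funS mh => //; exact: subset_neg.
- by move=> t /subset_neg /h01 /andP[h0 _]; rewrite lee_fin.
- by move=> t /=; rewrite !in_itv/= => /andP[yt ->]; rewrite (le_lt_trans xy).
Qed.

Lemma measurable_abs_iterated_rcons w c :
  subunit (fun t => abs_iterated w t * abs_letter c t) ->
  measurable_fun setT (abs_iterated (rcons w c)).
Proof.
move=> hs; rewrite (_ : abs_iterated _ = fun z : R =>
  \int[mu]_(t in `]z, (0 : R)[) (abs_iterated w t * abs_letter c t)); last first.
  by apply/funext => z; rewrite abs_iterated_rcons.
exact: measurable_Rintegral_subunit.
Qed.

(** If the previous integrand is at most 1, its integral over ]t, 0[ is at most -t, and every letter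
    is at most 1/(-t). The induction starts from 1/(1 - t) <= 1, hence the requirement that the
    first letter be [false]. *)
Lemma subunit_abs_iterated w c : head false (rcons w c) = false ->
  subunit (fun t => abs_iterated w t * abs_letter c t).
Proof.
elim/last_ind: w c => [|w c' IH] c hw.
  move: hw => /= ->; split.
    by apply: measurable_funM; [exact: measurable_cst|exact: measurable_abs_letter].
  move=> t tn; rewrite mul1r abs_letter_ge0//= invf_le1 ?lerDl ?oppr_ge0.
    by move: tn; rewrite /= in_itv/= => /ltW.
  by move: tn; rewrite /= in_itv/= => tn; rewrite subr_gt0 (lt_trans tn).
have {}IH : subunit (fun t => abs_iterated w t * abs_letter c' t).
  by apply: IH; move: hw; case: (w) => //.
split.
  apply: measurable_funM; last exact: measurable_abs_letter.
  by apply: measurable_funTS; exact: measurable_abs_iterated_rcons.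
move=> t tn; rewrite abs_iterated_rcons mulr_ge0 ?abs_letter_ge0 ?Rintegral_subunit_ge0//=.
have t0 : t < 0 by move: tn; rewrite /= in_itv.
rewrite -(@mulfV _ (- t)) ?oppr_eq0 ?lt_eqF//; apply: ler_pM.
- exact: Rintegral_subunit_ge0.
- exact: abs_letter_ge0.
- exact: Rintegral_subunit_le.
- exact: abs_letter_le.
Qed.

Definition letter c : R -> R := if c then fun t => t^-1 else fun t => (1 - t)^-1.

(** Integrating from 0 down to z < 0 costs a sign, which the negative density 1/t compensates and
    the positive density 1/(1 - t) does not. Only the letters [false] therefore contribute a factor
    -1. *)
Lemma iterated_integral_step v c (z : R) : head false (rcons v c) = false -> z < 0 ->
  (forall t, t < 0 -> iterated_integral (map letter v) t =
    (-1) ^+ (count negb v) * abs_iterated v t) ->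
  iterated_integral (map letter (rcons v c)) z =
  (-1) ^+ (count negb (rcons v c)) * abs_iterated (rcons v c) z.
Proof.
move=> hv z0 IH; have hs := subunit_abs_iterated hv.
set h := fun t => _ in hs.
pose sgn : R := (-1) ^+ (count negb v) * (if c then -1 else 1).
have fE t : z < t < 0 -> iterated_integral (map letter v) t * letter c t = sgn * h t.
  move=> /andP[_ t0]; rewrite IH// /h /sgn /letter /abs_letter.
  by case: c {hv hs h sgn}; rewrite ?invrN; ring.
have E : {in `]z, (0 : R)[, (fun t => iterated_integral (map letter v) t * letter c t) =1
    (fun t => sgn * h t)}.
  by move=> t; rewrite inE/= in_itv/=; exact: fE.
have mh : measurable_fun `]z, (0 : R)[ (fun t => sgn * h t).
  by apply: measurable_funM => //; apply: measurable_funS hs.1 => //; exact: subset_neg.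
rewrite map_rcons /iterated_integral foldl_rcons -/(iterated_integral _).
rewrite /oriented_integral leNgt z0 /=.
rewrite {1}/Rintegral integral_itv_bndoo; last first.
  apply/measurable_EFinP; apply: eq_measurable_fun mh => t tz.
  by rewrite E.
rewrite (_ : fine _ = \int[mu]_(t in `]z, (0 : R)[) (sgn * h t)); last first.
  by apply: eq_Rintegral => t tz; rewrite -E.
rewrite RintegralZl//; last exact: integrable_subunit.
rewrite abs_iterated_rcons -/h -cats1 count_cat /= addn0 exprD /sgn.
by case: (c); rewrite /= ?expr0 ?expr1; ring.
Qed.

Lemma iterated_integral_abs w c z : head false (rcons w c) = false -> z < 0 ->
  iterated_integral (map letter (rcons w c)) z =
  (-1) ^+ (count negb (rcons w c)) * abs_iterated (rcons w c) z.
Proof.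
elim/last_ind: w c z => [|v c' IH] c z hw z0; apply: iterated_integral_step => // t t0.
  by rewrite /iterated_integral /= mul1r.
by apply: IH => //; move: hw; case: (v).
Qed.

Lemma Li_abs (k : seq nat) z : is_composition k -> z < 0 ->
  Li k z = (-1) ^+ size k * abs_iterated (Li_word k) z.
Proof.
move=> kc z0; rewrite -count_Li_word.
have -> : Li k z = iterated_integral (map letter (Li_word k)) z.
  rewrite /Li /Li_word map_flatten -map_comp; congr (iterated_integral (flatten _) z).
  by apply: eq_map => ki /=; rewrite map_nseq.
have := Li_word_cons kc; case/lastP: (Li_word k) => // w c E.
by rewrite iterated_integral_abs// E.
Qed.

Lemma ln1B_ge0 (s : R) : neg s -> 0 <= ln (1 - s).
Proof. by rewrite /= in_itv/= => s0; rewrite ln_ge0// lerDl oppr_ge0 ltW. Qed.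

Lemma measurable_ln1B (D : set R) : measurable_fun D (fun s : R => ln (1 - s)).
Proof.
apply: measurable_funTS.
by apply: measurableT_comp; [exact: measurable_ln|exact: measurable_funB].
Qed.

(** With t = ln (1 - s), the density 1/(-s) is 1/(1 - s) times 1/(1 - e^(-t)). The letter [true]
    thus takes prefix sums first and then integrates like [false]. *)
Lemma integral_exp_series_letter m b c (z : R) : coef_ge0 b -> z <= 0 ->
  (\int[mu]_(s in `]-oo, z[) (exp_series m b (ln (1 - s)) * (abs_letter c s)%:E) =
   exp_series m (letter_coef c b) (ln (1 - z)))%E.
Proof.
move=> b0 z0.
have zneg s : `]-oo, z[ s -> neg s by rewrite /= !in_itv/= => /lt_le_trans; apply.
have H b' : coef_ge0 b' ->
  (\int[mu]_(s in `]-oo, z[) (exp_series m b' (ln (1 - s)) * (abs_letter false s)%:E) =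
   exp_series m (integrate_coef b') (ln (1 - z)))%E.
  move=> b'0; apply: integral_exp_series => //.
  - exact: measurable_ln1B.
  - by apply: measurable_funS (measurable_abs_letter false) => //.
  - by move=> s /zneg /ln1B_ge0.
  - by move=> s /zneg /abs_letter_ge0.
  - by move=> n i; rewrite integral_exp_monomial_ln.
case: c; last exact: H.
rewrite -[RHS]H; last exact: prefix_sum_ge0.
apply: eq_integral => s; rewrite inE => /zneg; rewrite /= in_itv/= => s0.
have s1 : 0 < 1 - s by rewrite subr_gt0 (lt_trans s0).
rewrite exp_series_prefix_sum//; last by rewrite ln_gt0// ltrDl oppr_gt0.
rewrite expRN lnK ?posrE// [RHS]muleC muleA -EFinM muleC; congr (_%:E * _)%E.
by rewrite -invfM mulrBr mulr1 mulfV ?gt_eqF// addrAC subrr add0r.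
Qed.

(** Induction from the outermost letter: for a fixed inner variable t, Tonelli lets the outer
    variable s run over ]-oo, t[, so the outermost letter acts on the series and leaves a shorter
    word. *)
Lemma integral_exp_series_abs_iterated m w c b : coef_ge0 b ->
  head false (rcons w c) = false ->
  (\int[mu]_(s in neg) ((abs_iterated w s * abs_letter c s)%:E *
      exp_series m b (ln (1 - s))) =
   exp_series m (foldr letter_coef b (rcons w c)) 0)%E.
Proof.
elim/last_ind: w c b => [|w c' IH] c b b0 hw.
  (* The evaluation point 0 is rewritten as ln (1 - 0). *)
  rewrite -[X in exp_series _ _ X](@ln1 R) -[X in ln X](subr0 1).
  rewrite -integral_exp_series_letter//; apply: eq_integral => s _.
  by rewrite mul1r muleC.
have hw' : head false (rcons w c') = false by move: hw; case: (w).
have hs := subunit_abs_iterated hw'; set h := fun t => _ in hs.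
(* The bound is written [id s] to fit the function [phi] of [tonelli_triangle]. *)
transitivity (\int[mu]_(s in neg) ((exp_series m b (ln (1 - s)) * (abs_letter c s)%:E) *
    \int[mu]_(t in `](id s), 0%R[) (h t)%:E))%E.
  apply: eq_integral => s _.
  by rewrite abs_iterated_rcons -Rintegral_subunitE// EFinM muleC -muleA [X in (_ * X)%E]muleC.
rewrite tonelli_triangle//; last 4 first.
- apply: emeasurable_funM; last by apply/measurable_EFinP; exact: measurable_abs_letter.
  apply: measurable_exp_series => //; first exact: measurable_ln1B.
  exact: ln1B_ge0.
- by apply/measurable_EFinP; exact: hs.1.
- by move=> t tn; rewrite mule_ge0 ?exp_series_ge0 ?ln1B_ge0 ?lee_fin ?abs_letter_ge0.
- by move=> s /hs.2 /andP[h0 _]; rewrite lee_fin.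
rewrite foldr_rcons -IH//; last exact: letter_coef_ge0.
apply: eq_integral => s; rewrite inE => sn; congr (_ * _)%E.
have s0 : s < 0 by move: sn; rewrite /= in_itv.
rewrite -integral_exp_series_letter ?(ltW s0)//; congr (integral _ _ _).
apply/seteqP; split => t /=; rewrite !in_itv/=; first by case.
by move=> ts; split => //; exact: lt_trans ts s0.
Qed.

End IteratedIntegrals.

(** * The eta function at positive integers *)

Section EtaValue.
Context {R : realType}.
Local Open Scope classical_set_scope.
Local Notation mu := (@lebesgue_measure R).

Lemma unit_coef_ge0 : coef_ge0 (@unit_coef R).
Proof. by move=> n d; rewrite /unit_coef ler0n. Qed.

Lemma exp_series_unit m (t : R) :
  (exp_series m unit_coef t = (exp_monomial 0 m t)%:E)%E.
Proof.
rewrite /exp_series (_ : (exp_monomial 0 m t) =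
  \sum_(d < m.+1) unit_coef 0 d * exp_monomial 0 (m - d) t); last first.
  by rewrite big_ord_recl /= subn0 /unit_coef/= mul1r big1 ?addr0// => d _; rewrite mul0r.
apply/cvg_lim => //; apply: cvg_near_cst; exists 1%N => // n /= n0.
rewrite sumEFin; case: n n0 => // n _; rewrite big_nat_recl//= [X in _ + X]big1 ?addr0// => i _.
by rewrite big1// => d _; rewrite mul0r.
Qed.

(** This is e^(-t)/(1 - e^(-t)) = 1/(e^t - 1): up to sign and m!, the kernel in the integral
    defining eta. *)
Lemma exp_series_prefix_unit m (t : R) : 0 < t ->
  (exp_series m (prefix_sum unit_coef) t = (t ^+ m / m`!%:R / (expR t - 1))%:E)%E.
Proof.
move=> t0; rewrite (exp_series_prefix_sum _ unit_coef_ge0 t0).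
rewrite exp_series_unit -EFinM; congr EFin.
rewrite /exp_monomial mul1r expRN.
have e0 : expR t != 0 by rewrite gt_eqF// expR_gt0.
have e1 : expR t - 1 != 0 by rewrite subr_eq0 gt_eqF// expR_gt1.
have m0 : (m`!%:R : R) != 0 by rewrite pnatr_eq0 -lt0n fact_gt0.
by field; rewrite e0 e1 m0.
Qed.

Lemma measurable_exp_series_prefix_unit m :
  measurable_fun (`]0, +oo[ : set R) (exp_series m (prefix_sum unit_coef)).
Proof.
apply: (@measurable_exp_series _ m (prefix_sum unit_coef) _ id) => //.
  by apply: prefix_sum_ge0; exact: unit_coef_ge0.
by move=> t /=; rewrite in_itv/= andbT => /ltW.
Qed.

(** The integrand is m! times [exp_monomial 0 m], whose tail at 0 equals 1. *)
Lemma Gamma_nat m : Gamma (m%:R + 1 : R) = m`!%:R.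
Proof.
have m0 : (m`!%:R : R) != 0 by rewrite pnatr_eq0 -lt0n fact_gt0.
rewrite /Gamma /Rintegral.
have -> : (\int[mu]_(t in `]0%R, +oo[) (t `^ (m%:R + 1 - 1) * expR (- t))%R%:E =
   \int[mu]_(t in `]0%R, +oo[) (m`!%:R%:E * (exp_monomial 0 m t)%:E))%E.
  apply: eq_integral => t; rewrite inE/= in_itv/= andbT => t0.
  rewrite addrK powR_mulrn ?(ltW t0)// -EFinM /exp_monomial mul1r; congr EFin.
  by field.
rewrite ge0_integralZl ?lee_fin//; last 2 first.
- apply/measurable_EFinP; apply: measurable_funTS; exact: measurable_exp_monomial.
- move=> t; rewrite /= in_itv/= andbT => t0.
  by rewrite lee_fin exp_monomial_ge0// ltW.
rewrite integral_exp_monomial// -EFinM /= /exp_monomial_tail big_ord_recr/= big1 ?add0r.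
  by rewrite subnn /exp_monomial mulr0 oppr0 expR0 fact0 expr1n invr1 expr0 !mulr1.
move=> d _; rewrite /exp_monomial -(@prednK (m - d)) ?subn_gt0//.
by rewrite exprS !mul0r mulr0 mul0r.
Qed.

(** The kernel acts as one more letter [true] at the end of the word: its series already holds the
    prefix sums, and the condition 1 - e^t < s, that is t > ln (1 - s), supplies the integration. *)
Lemma integral_exp_series_Li m w c : head false (rcons w c) = false ->
  (\int[mu]_(t in `]0%R, +oo[) (exp_series m (prefix_sum unit_coef) t *
      (abs_iterated (rcons w c) (1 - expR t))%:E) =
   \sum_(n <oo) (foldr letter_coef unit_coef (rcons (rcons w c) true) n m)%:E)%E.
Proof.
move=> hw.
have u0 := unit_coef_ge0.
have p0 : coef_ge0 (prefix_sum (@unit_coef R)) by exact: prefix_sum_ge0.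
have hs : subunit (fun t : R => abs_iterated w t * abs_letter c t) by exact: subunit_abs_iterated.
set h := fun t => _ in hs.
have pos t : `]0, +oo[ t -> (0 : R) <= t by rewrite /= in_itv/= andbT => /ltW.
transitivity (\int[mu]_(t in `]0%R, +oo[) (exp_series m (prefix_sum unit_coef) t *
    \int[mu]_(s in `](1 - expR t)%R, 0%R[) (h s)%:E))%E.
  by apply: eq_integral => t _; rewrite abs_iterated_rcons -Rintegral_subunitE.
rewrite (@tonelli_triangle _ _ (fun t => 1 - expR t))//; last 5 first.
- by apply: measurable_funB => //; exact: measurable_expR.
- exact: measurable_exp_series_prefix_unit.
- by apply/measurable_EFinP; exact: hs.1.
- by move=> t /pos t0; exact: exp_series_ge0.
- by move=> s /hs.2 /andP[h0 _]; rewrite lee_fin.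
rewrite foldr_rcons -exp_series0; last first.
  elim: (rcons w c) => [|c' v IH] /=; exact: letter_coef_ge0.
rewrite -integral_exp_series_abs_iterated//; last exact: letter_coef_ge0.
apply: eq_integral => s; rewrite inE => sn; congr (_ * _)%E.
have s0 : s < 0 by move: sn; rewrite /= in_itv.
have T0 := ln1B_ge0 sn.
have T1 : expR (ln (1 - s)) = 1 - s by rewrite lnK// posrE subr_gt0 (lt_trans s0).
have -> : `]0, +oo[ `&` [set t | 1 - expR t < s] = `]ln (1 - s), +oo[.
  have tE t : (1 - expR t < s) = (ln (1 - s) < t).
    by rewrite -[RHS]ltr_expR T1 ltrBlDr -ltrBlDl.
  apply/seteqP; split => t /=; rewrite !in_itv/= !andbT tE; first by case.
  by move=> Tt; split => //; exact: le_lt_trans T0 Tt.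
rewrite letter_coef_true -(@integral_exp_series _ `]ln (1 - s), +oo[ id (cst 1))//.
- by apply: eq_integral => t _; rewrite mule1.
- by move=> t; rewrite /= in_itv/= andbT => Tt; rewrite (le_trans T0)// ltW.
- by move=> n i; rewrite -integral_exp_monomial//; apply: eq_integral => t _; rewrite mulr1.
Qed.

(** The sign (-1)^r of the polylogarithm and the sign of 1/(1 - e^t) combine to (-1)^(r-1), and
    Gamma(m + 1) cancels the m! brought in by the monomials. *)
Lemma eta_nat m k : is_composition k ->
  (eta (m%:R + 1 : R) k = ((-1) ^+ (size k - 1))%:E *
   \sum_(n <oo) (foldr letter_coef unit_coef (rcons (Li_word k) true) n m)%:E)%E.
Proof.
move=> kc; have /andP[k0 _] := kc.
have m0 : (m`!%:R : R) != 0 by rewrite pnatr_eq0 -lt0n fact_gt0.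
rewrite /eta Gamma_nat.
pose g (t : R) := (exp_series m (prefix_sum unit_coef) t * (abs_iterated (Li_word k) (1 - expR t))%:E)%E.
have Li0 := Li_word_cons kc.
have [w [c Ew]] : exists w c, Li_word k = rcons w c.
  by move: Li0; case/lastP: (Li_word k) => // w c _; exists w, c.
have hw : head false (rcons w c) = false by rewrite -Ew Li0.
have g0 (t : R) : `]0, +oo[ t -> (0 <= g t)%E.
  rewrite /= in_itv/= andbT => t0; rewrite mule_ge0//.
    by apply: exp_series_ge0 (ltW t0); apply: prefix_sum_ge0; exact: unit_coef_ge0.
  rewrite lee_fin Ew abs_iterated_rcons Rintegral_subunit_ge0//.
  exact: subunit_abs_iterated.
have -> : (\int[mu]_(t in `]0%R, +oo[)
    (t `^ (m%:R + 1 - 1) / (1 - expR t) * Li k (1 - expR t))%R%:E =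
    \int[mu]_(t in `]0%R, +oo[) (((-1) ^+ (size k - 1))%:E * (m`!%:R%:E * g t)))%E.
  apply: eq_integral => t; rewrite inE/= in_itv/= andbT => t0.
  rewrite addrK powR_mulrn ?(ltW t0)// Li_abs//; last by rewrite subr_lt0 expR_gt1.
  rewrite /g exp_series_prefix_unit// -!EFinM; congr EFin.
  rewrite -[in LHS](subnK k0) addn1 exprS.
  have e1 : expR t - 1 != 0 by rewrite subr_eq0 gt_eqF// expR_gt1.
  have e2 : 1 - expR t != 0 by rewrite -opprB oppr_eq0.
  by field; rewrite e1 e2 m0.
have -> : (\int[mu]_(t in `]0%R, +oo[) (((-1) ^+ (size k - 1))%:E * (m`!%:R%:E * g t)) =
   ((-1) ^+ (size k - 1))%:E * (m`!%:R%:E * \int[mu]_(t in `]0%R, +oo[) g t))%E.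
  have mg : measurable_fun (`]0, +oo[ : set R) g.
    apply: emeasurable_funM.
      exact: measurable_exp_series_prefix_unit.
    apply/measurable_EFinP; apply: measurable_funTS; rewrite Ew.
    apply: (@measurableT_comp _ _ _ _ _ _ (abs_iterated (rcons w c)) _ (fun t => 1 - expR t)).
      by apply: measurable_abs_iterated_rcons; exact: subunit_abs_iterated.
    by apply: measurable_funB => //; exact: measurable_expR.
  rewrite -ge0_integralZl// ?lee_fin//.
  have mg0 t : `]0, +oo[ t -> (0 <= m`!%:R%:E * g t)%E.
    by move=> /g0 gt0; rewrite mule_ge0// lee_fin.
  (* The sign is taken out by parity, since the remaining integrand is nonnegative. *)
  rewrite -signr_odd; case: odd => /=; last first.
    by rewrite expr0 mul1e; under eq_integral do rewrite mul1e.
  rewrite expr1 EFinN mulN1e -integral_ge0N//.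
  by apply: eq_integral => t _; rewrite mulN1e.
rewrite /g Ew integral_exp_series_Li// muleCA; congr (_ * _)%E.
by rewrite muleA -EFinM mulVf// mul1e.
Qed.

End EtaValue.

(* The entries of j are at most m because they sum to m. *)
Theorem corollary2p4 (R : realType) (k : seq nat) (m : nat)
    (hk : is_composition k) :
  let n := (sumn k + 1 - size k)%N in
  let kd := incr_first (hoffman_dual (rev k)) in
  eta (m%:R + 1 : R) k =
  ((((-1) ^+ (size k - 1))%:E : \bar R) *
   \sum_(j : n.-tuple 'I_m.+1 | sumn (map val j) == m)
     (((B_coef kd (map val j))%:R)%:E * zeta_star R (add_seq kd (map val j))))%E.
Proof.
move=> n kd.
have kc' : is_composition (rev k) by rewrite /is_composition size_rev all_rev.
(* The leading [false] of the word raises the first component of the dual; the appended [true] comes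
   from the kernel of eta. *)
have kdE : composition_of_word (rcons (Li_word k) true) = kd.
  by rewrite (Li_word_cons hk) /kd hoffman_dual_Li_word.
have nE : n = size kd.
  by rewrite /n /kd size_incr_first size_hoffman_dual// sumn_rev size_rev.
(* The tuple length becomes [size kd] itself, as [star_coefE] requires. *)
clearbody n; subst n.
rewrite eta_nat// star_coef_of_word kdE; congr (_ * _)%E.
have [a [l kd0]] : exists a l, kd = a :: l.
  rewrite -kdE; have [a [l ->]] := composition_of_word_cons (Li_word k).
  by exists a.+1, l.
clear kdE; clearbody kd; subst kd.
(* Each coefficient is expanded over j; nonnegativity then exchanges the finite sum with the
   series. *)
transitivity (\sum_(n <oo) \sum_(j : (size (a :: l)).-tuple 'I_m.+1 | sumn (map val j) == m)
   (((B_coef (a :: l) (map val j))%:R)%:E * (star_term (add_seq (a :: l) (map val j)) n : R)%:E))%E.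
  apply: eq_eseriesr => n _; rewrite (star_coefE _ _ (leqnn m)) -sumEFin.
  by apply: eq_bigr => j _; rewrite EFinM.
rewrite nneseries_sum; last first.
  by move=> j n _; rewrite mule_ge0// lee_fin ?ler0n// star_term_ge0.
apply: eq_bigr => j _; rewrite nneseriesZl; last first.
  by move=> n _; rewrite lee_fin star_term_ge0.
congr (_ * _)%E.
by case/tupleP: j => x j; rewrite /add_seq /= zeta_starE.
Qed.
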